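(* For every C*-factor $A$ one of the following holds: (a) $A$ is of type $I_n$ for some natural number $n$; (b) $A$ is of type $I_n$ for some infinite cardinal number $n$; (c) $A$ is of type $II_1$; (d) $A$ is of type $II_\infty$; (e) $A$ is of type III.
   Context: A C*-algebra $A$ is a C*-factor if it has no nonzero proper two-sided ideals $I,J$ with $IJ=\{ab:a\in I,b\in J\}=\{0\}$. For a C*-algebra $B$ and $S\subseteq B$, $\mathrm{Ann}_B(S)=\{a\in B: as+sa=0\ \forall s\in S\}$; $\mathcal{P}_B=\{\mathrm{Ann}_B(\mathrm{Ann}_B(S)): S\subseteq B_+\}$ is the lattice of annihilators (ordered by inclusion, complete; suprema taken in $\mathcal{P}_B$). For $V\subseteq B$, ${}^dV=\{a\in B: xay+yax=0\ \forall x,y\in V\}$. $V\in\mathcal{P}_B$ is central if ${}^d(\mathrm{Ann}_B(\mathrm{Ann}_B(S)))\cap{}^d(\mathrm{Ann}_B(S))=\{0\}$ where $S\subseteq B_+$, $V=\mathrm{Ann}_B(\mathrm{Ann}_B(S))$. The central support $c(V)$ is the greatest lower bound in $\mathcal{P}_B$ of central annihilators containing $V$. $V$ is Abelian if commutative; $V,W$ are orthogonal if $\{vw\}=\{0\}$. Each $V\in\mathcal{P}_B$ is a C*-subalgebra; $V$ is modular if $\mathcal{P}_V$ (computed inside $V$) is a modular lattice. $\mathcal{P}_B$ is locally modular if there is a family of modular annihilators $\{V_\xi\}$ whose central supports $\{Z_\xi\}$ are pairwise orthogonal with $\sup_\xi Z_\xi=B$; purely nonmodular if there is no nonzero modular annihilator.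 Types: for a cardinal $n$, $B$ is of type $I_n$ if there is a family $\{P_i\}_{i\in\Xi}$, $|\Xi|=n$, of pairwise orthogonal Abelian annihilators with central support $B$ and $\sup_iP_i=B$; $B$ is of type $II_1$ if $\mathcal{P}_B$ is modular; of type $II_\infty$ if $\mathcal{P}_B$ is locally modular and the annihilator $B$ is not modular; of type III if $\mathcal{P}_B$ is purely nonmodular. *)

(* Defs.v *)
From HB Require Import structures.
From mathcomp Require Import all_boot all_algebra complex.
From mathcomp Require Import classical_sets cardinality reals.

Set Implicit Arguments.
Unset Strict Implicit.
Unset Printing Implicit Defensive.

Import GRing.Theory Num.Theory.
Local Open Scope ring_scope.

Record CStarAlgebra (R : realType) := {
  cs_V : lmodType R[i];
  cs_mul : cs_V -> cs_V -> cs_V;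
  cs_star : cs_V -> cs_V;
  cs_norm : cs_V -> R;
  cs_mulA : forall x y z, cs_mul x (cs_mul y z) = cs_mul (cs_mul x y) z;
  cs_mulDl : forall x y z, cs_mul (x + y) z = cs_mul x z + cs_mul y z;
  cs_mulDr : forall x y z, cs_mul x (y + z) = cs_mul x y + cs_mul x z;
  cs_mulZl : forall (a : R[i]) x y, cs_mul (a *: x) y = a *: cs_mul x y;
  cs_mulZr : forall (a : R[i]) x y, cs_mul x (a *: y) = a *: cs_mul x y;
  cs_starK : forall x, cs_star (cs_star x) = x;
  cs_starD : forall x y, cs_star (x + y) = cs_star x + cs_star y;
  cs_starZ : forall (a : R[i]) x, cs_star (a *: x) = Num.conj a *: cs_star x;
  cs_starM : forall x y, cs_star (cs_mul x y) = cs_mul (cs_star y) (cs_star x);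
  cs_norm_ge0 : forall x, 0 <= cs_norm x;
  cs_norm_eq0 : forall x, cs_norm x = 0 -> x = 0;
  cs_normD : forall x y, cs_norm (x + y) <= cs_norm x + cs_norm y;
  cs_normZ : forall (a : R[i]) x,
      real_complex R (cs_norm (a *: x)) = `|a| * real_complex R (cs_norm x);
  cs_normM : forall x y, cs_norm (cs_mul x y) <= cs_norm x * cs_norm y;
  cs_normC : forall x, cs_norm (cs_mul (cs_star x) x) = cs_norm x ^+ 2;
  cs_complete : forall u : nat -> cs_V,
      (forall e : R, 0 < e -> exists N : nat, forall m n : nat,
          (N <= m)%N -> (N <= n)%N -> cs_norm (u m - u n) < e) ->
      exists l : cs_V, forall e : R, 0 < e -> exists N : nat, forall n : nat,
          (N <= n)%N -> cs_norm (u n - l) < e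
}.

Local Open Scope classical_set_scope.

Section CStarNotions.
Variables (R : realType) (A : CStarAlgebra R).
Local Notation T := (cs_V A).
Local Notation mul := (@cs_mul R A).
Local Notation star := (@cs_star R A).

Definition zeroset : set T := [set x | x = 0%R].

Definition is_ideal (I : set T) : Prop :=
  I 0%R /\ (forall x y, I x -> I y -> I (x + y)%R) /\
  (forall (a : R[i]) x, I x -> I (a *: x)%R) /\
  (forall b x, I x -> I (mul b x) /\ I (mul x b)).

Definition cfactor : Prop :=
  forall I J : set T, is_ideal I -> is_ideal J ->
    I <> zeroset -> J <> zeroset -> I <> setT -> J <> setT ->
    ~ (forall a b, I a -> J b -> mul a b = 0%R).

(* Everything relative to a "universe" U (U = setT for B itself, U = V for
   computations inside an annihilator V viewed as a C*-algebra). *)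
Definition pos (U : set T) : set T :=
  [set x | exists b, U b /\ x = mul (star b) b].

Definition Ann (U S : set T) : set T :=
  [set a | U a /\ forall s, S s -> (mul a s + mul s a)%R = 0%R].

Definition PA (U : set T) : set (set T) :=
  [set V | exists S, S `<=` pos U /\ V = Ann U (Ann U S)].

Definition is_lub (U : set T) (F : set (set T)) (V : set T) : Prop :=
  PA U V /\ (forall W, F W -> W `<=` V) /\
  (forall W, PA U W -> (forall X, F X -> X `<=` W) -> V `<=` W).

Definition is_glb (U : set T) (F : set (set T)) (V : set T) : Prop :=
  PA U V /\ (forall W, F W -> V `<=` W) /\
  (forall W, PA U W -> (forall X, F X -> W `<=` X) -> W `<=` V).

Definition pair_set (X Y : set T) : set (set T) := [set W | W = X \/ W = Y].

Definition fam_range (Xi : Type) (F : Xi -> set T) : set (set T) :=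
  [set W | exists i, W = F i].

Definition dual (V : set T) : set T :=
  [set a | forall x y, V x -> V y -> (mul x (mul a y) + mul y (mul a x))%R = 0%R].

Definition central (V : set T) : Prop :=
  exists S, S `<=` pos setT /\ V = Ann setT (Ann setT S) /\
    dual (Ann setT (Ann setT S)) `&` dual (Ann setT S) = zeroset.

Definition central_support (V Z : set T) : Prop :=
  is_glb setT [set W | central W /\ V `<=` W] Z.

Definition abelian (V : set T) : Prop :=
  forall x y, V x -> V y -> mul x y = mul y x.

Definition orthogonal (V W : set T) : Prop :=
  forall v w, V v -> W w -> mul v w = 0%R.

Definition modular (U : set T) : Prop :=
  forall X Y Z, PA U X -> PA U Y -> PA U Z -> X `<=` Z ->
  forall J M L K,
    is_lub U (pair_set X Y) J -> is_glb U (pair_set Y Z) M ->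
    is_lub U (pair_set X M) L -> is_glb U (pair_set J Z) K -> L = K.

Definition modular_annihilator (V : set T) : Prop := PA setT V /\ modular V.

Definition locally_modular : Prop :=
  exists (Xi : Type) (Vf Zf : Xi -> set T),
    (forall i, modular_annihilator (Vf i)) /\
    (forall i, central_support (Vf i) (Zf i)) /\
    (forall i j, i <> j -> orthogonal (Zf i) (Zf j)) /\
    is_lub setT (fam_range Zf) setT.

Definition purely_nonmodular : Prop :=
  forall V, modular_annihilator V -> V = zeroset.

(* type I_n, n = |Xi| *)
Definition type_I (Xi : Type) : Prop :=
  exists P : Xi -> set T,
    (forall i, PA setT (P i) /\ abelian (P i) /\ central_support (P i) setT) /\
    (forall i j, i <> j -> orthogonal (P i) (P j)) /\
    is_lub setT (fam_range P) setT.

Definition type_II1 : Prop := modular setT.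
Definition type_IIinf : Prop := locally_modular /\ ~ modular setT.
Definition type_III : Prop := purely_nonmodular.

End CStarNotions.

(* Main.v *)
Require Import Defs.
From mathcomp Require Import all_boot all_order all_algebra complex.
From mathcomp Require Import cyclic separable cyclotomic ring lra zify.
From mathcomp Require Import boolp classical_sets cardinality reals.

(* If [A] is not modular and not purely nonmodular, it has a nonzero modular
   annihilator [V], and it suffices that the central support of [V] is all of [A],
   i.e. that a C*-factor has no central annihilators besides [0] and [A]; then
   [{V}] witnesses local modularity. Type I is never needed.

   The analytic input is that [a s + s a = 0] with [s = b^* b] forces
   [a s = s a = 0], which turns [Ann] of a set of positive elements into a
   genuine two-sided annihilator. It is proved here directly from the C*-identity,
   without functional calculus, spectra or completeness. For [a] self-adjoint put
   [y = b a] and [p = s a^2 = - y^* y]. As in the Fukamiya-Kaplansky argument,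
   take [z = y (1 + k p)]: [- z^* z = p (1 + k p)^2] is bounded below by
   a small multiple of [- |p|]; [z z^* + z^* z] is a sum of squares, so
   [z z^*] has the same lower bound; and lower bounds transfer from [c d] to
   [d c], hence hold for [z^* z] and, because [a p = - p a], for
   [p (1 - k p)^2]. Adding up, [0 <= p^2 <= 189/400 |p|^2]. Lower bounds of [H] and
   [- H] control the norm of [H] up to the factor 3125/1024, which is still enough
   to contradict [|p^2| = |p|^2] when [p != 0]. *)

Set Implicit Arguments.
Unset Strict Implicit.
Unset Printing Implicit Defensive.

Import Order.TTheory GRing.Theory Num.Theory.
Local Open Scope ring_scope.
Local Open Scope complex_scope.
Local Open Scope classical_set_scope.

Local Notation "x ** y" := (@cs_mul _ _ x y) (at level 40, left associativity).
Local Notation "x ^#" := (@cs_star _ _ x) (at level 2, format "x ^#").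

(** * Auxiliary inequalities and roots of unity *)

Lemma bernoulli (R : realDomainType) (n : nat) (h : R) :
  -1 <= h -> 1 + n%:R * h <= (1 + h) ^+ n.
Proof.
move=> h1; elim: n => [|n IH]; first by rewrite mul0r addr0 expr0.
rewrite exprS; have h0 : 0 <= 1 + h by lra.
apply: le_trans (ler_wpM2l h0 IH).
have : 0 <= n%:R * h ^+ 2 by rewrite mulr_ge0 ?ler0n ?sqr_ge0.
rewrite -natr1; nra.
Qed.

(** If [r = 1 + h] with [h > 0], squaring Bernoulli's inequality at exponent [n = 2 ^ k] makes
    [r ^+ (2 * n)] grow at least like [n ^ 2 * h ^ 2], which beats the linear bound [1 + 2 * n * K]
    for large [k]. *)
Lemma le1_of_expr2n_le (R : archiRealFieldType) (r K : R) : 0 <= K ->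
  (forall k, r ^+ (2 ^ k) <= 1 + (2 ^ k)%:R * K) -> r <= 1.
Proof.
move=> K0 H; rewrite leNgt; apply/negP => r1.
set h := r - 1; have h0 : 0 < h by rewrite subr_gt0.
have re : r = 1 + h by rewrite /h; ring.
have q0 : 0 <= 2 * K / h ^+ 2 by rewrite divr_ge0 ?sqr_ge0 // mulr_ge0.
set k := Num.bound (2 * K / h ^+ 2).
have nk : 2 * K / h ^+ 2 < (2 ^ k)%:R.
  apply: lt_le_trans (archi_boundP q0) _.
  by rewrite ler_nat ltnW // ltn_expl.
rewrite ltr_pdivrMr ?exprn_gt0 // in nk.
have hm : -1 <= h by lra.
have B := bernoulli (2 ^ k) hm; have := H k.+1.
rewrite expnSr exprM natrM re; set n : R := (2 ^ k)%:R in nk B *.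
have n0 : 0 <= n by rewrite ler0n.
have nh : 0 <= n * h by rewrite mulr_ge0 // ltW.
have : (1 + n * h) ^+ 2 <= ((1 + h) ^+ (2 ^ k)) ^+ 2.
  by rewrite lerXn2r // ?nnegrE; lra.
have : n * (2 * K) <= n * (n * h ^+ 2) by rewrite ler_wpM2l // ltW.
have n1 : 1 <= n by rewrite /n ler1n expn_gt0.
have : 0 < n * h by rewrite mulr_gt0 //; lra.
move: ((1 + h) ^+ _) => X; nra.
Qed.

(** An elementary stand-in for [exp (4 / 5)]: Bernoulli for [1 - h] gives [(1 - h) ^+ n >= 4 / 5],
    and [(1 + h) * (1 - h) <= 1] turns this into [(1 + h) ^+ n <= 5 / 4]. The fourth power is the
    claim. *)
Lemma expr_1p_inv_le (R : realFieldType) (n : nat) : (0 < n)%N ->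
  (1 + (5 * n%:R)^-1 : R) ^+ (4 * n) <= 625%:R / 256%:R.
Proof.
move=> n0; have n1 : (0 : R) < n%:R by rewrite ltr0n.
set h : R := (5 * n%:R)^-1.
have nh : n%:R * h = 5^-1 by rewrite /h; field; rewrite pnatr_eq0 -lt0n n0.
have h0 : 0 < h by rewrite invr_gt0 mulr_gt0.
have h1 : h <= 5^-1.
  by rewrite lef_pV2 ?posrE ?mulr_gt0 // ler_peMr // ler1n.
have b1 : 4 / 5 <= (1 - h) ^+ n.
  have hm : -1 <= - h by lra.
  by have := bernoulli n hm; rewrite mulrN nh; lra.
have b2 : (1 + h) ^+ n * (1 - h) ^+ n <= 1.
  by rewrite -exprMn exprn_ile1 //; nra.
have b3 : (1 + h) ^+ n <= 5 / 4.
  have : 0 < (1 + h) ^+ n by rewrite exprn_gt0 //; lra.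
  nra.
rewrite mulnC exprM.
have -> : 625%:R / 256%:R = (5 / 4 : R) ^+ 4 by field.
by rewrite lerXn2r // ?nnegrE ?divr_ge0 // exprn_ge0 //; lra.
Qed.

Lemma prim_root_exists (F : closedFieldType) (n : nat) :
  (0 < n)%N -> n%:R != 0 :> F -> exists z : F, n.-primitive_root z.
Proof.
move=> n_gt0 n_neq0; pose p : {poly F} := 'X^n - 1.
have [r Dp] := closed_field_poly_normal p.
rewrite (monicP _) ?monicXnsubC // scale1r in Dp.
have rn1 : all n.-unity_root r by apply/allP=> z; rewrite -root_prod_XsubC -Dp.
have sz_r : (n < (size r).+1)%N.
  by rewrite -(size_prod_XsubC r id) -Dp size_XnsubC.
have [|z] := hasP (has_prim_root n_gt0 rn1 _ sz_r); last by exists z.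
by rewrite -separable_prod_XsubC -Dp separable_Xn_sub_1.
Qed.

(** * Normed *-algebra identities *)

Section CStarAlgebraTheory.
Variables (R : realType) (A : CStarAlgebra R).
Local Notation T := (cs_V A).
Local Notation N := (@cs_norm R A).
Local Notation "x ** y" := (@cs_mul R A x y) (at level 40, left associativity).
Implicit Types (x y z a b c d h s : T) (t u m e : R) (P Q H : T -> T).

Lemma cs_mul0l x : 0 ** x = 0.
Proof. by apply: (@addrI _ (0 ** x)); rewrite -cs_mulDl !addr0. Qed.

Lemma cs_mul0r x : x ** 0 = 0.
Proof. by apply: (@addrI _ (x ** 0)); rewrite -cs_mulDr !addr0. Qed.

Lemma cs_mulNl x y : (- x) ** y = - (x ** y).
Proof. by rewrite -scaleN1r cs_mulZl scaleN1r. Qed.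

Lemma cs_mulNr x y : x ** (- y) = - (x ** y).
Proof. by rewrite -scaleN1r cs_mulZr scaleN1r. Qed.

Lemma cs_mulBl x y z : (x - y) ** z = x ** z - y ** z.
Proof. by rewrite cs_mulDl cs_mulNl. Qed.

Lemma cs_mulBr x y z : x ** (y - z) = x ** y - x ** z.
Proof. by rewrite cs_mulDr cs_mulNr. Qed.

Lemma cs_star0 : (0 : T)^# = 0.
Proof. by rewrite -[in LHS](scale0r (0 : T)) cs_starZ rmorph0 scale0r. Qed.

Lemma cs_starN x : (- x)^# = - x^#.
Proof. by rewrite -scaleN1r cs_starZ rmorphN1 scaleN1r. Qed.

Lemma cs_starB x y : (x - y)^# = x^# - y^#.
Proof. by rewrite cs_starD cs_starN. Qed.

Lemma cs_starZR t x : (t%:C *: x)^# = t%:C *: x^#.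
Proof. by rewrite cs_starZ conj_Creal //; apply/complex_realP; exists t. Qed.

Lemma cs_starZi x : ('i *: x)^# = - ('i *: x^#).
Proof.
rewrite cs_starZ -scaleNr; congr (_ *: _).
by apply/eqP; rewrite eq_complex /= oppr0 !eqxx.
Qed.

Lemma cs_norm0 : N 0 = 0.
Proof.
apply: (@complexI R); rewrite -[X in N X](scale0r (0 : T)).
by rewrite cs_normZ normr0 mul0r.
Qed.

Lemma cs_normZR t x : N (t%:C *: x) = `|t| * N x.
Proof.
apply: (@complexI R); rewrite cs_normZ rmorphM /=; congr (_ * _).
by rewrite normc_def /= expr0n addr0 sqrtr_sqr.
Qed.

Lemma cs_norm_unit (k : R[i]) x : `|k| = 1 -> N (k *: x) = N x.
Proof. by move=> k1; apply: (@complexI R); rewrite cs_normZ k1 mul1r. Qed.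

Lemma normi : `|'i%C : R[i]| = 1.
Proof. by rewrite normc_def /= expr0n add0r expr1n sqrtr1. Qed.

Lemma cs_normN x : N (- x) = N x.
Proof. by rewrite -scaleN1r cs_norm_unit // normrN1. Qed.

Lemma cs_normB x y : N (x - y) <= N x + N y.
Proof. by rewrite -[N y]cs_normN cs_normD. Qed.

Lemma cs_norm_sum (I : Type) (r : seq I) (F : I -> T) :
  N (\sum_(i <- r) F i) <= \sum_(i <- r) N (F i).
Proof.
apply: (big_ind2 (fun x (t : R) => N x <= t)); rewrite ?cs_norm0 //.
by move=> x1 t1 x2 t2 H1 H2; apply: le_trans (cs_normD _ _) (lerD H1 H2).
Qed.

Lemma cs_norm_eq0E x : (N x == 0) = (x == 0).
Proof. by apply/eqP/eqP => [/cs_norm_eq0|->]; rewrite ?cs_norm0. Qed.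

Lemma cs_norm_gt0 x : x <> 0 -> 0 < N x.
Proof. by move=> /eqP x0; rewrite lt0r cs_norm_eq0E x0 cs_norm_ge0. Qed.

Lemma cs_norm_star x : N x^# = N x.
Proof.
suff H y : N y <= N y^# by apply/eqP; rewrite eq_le {1}(le_trans (H _)) ?cs_starK ?H.
have [->|/cs_norm_gt0 y0] := pselect (y = 0); first by rewrite cs_norm0 cs_norm_ge0.
by rewrite -(ler_pM2r y0) -expr2 -cs_normC cs_normM.
Qed.

Lemma star_mul_eq0 x : x^# ** x = 0 -> x = 0.
Proof.
move=> E; apply: cs_norm_eq0; apply/eqP.
by rewrite -sqrf_eq0 -cs_normC E cs_norm0.
Qed.

Lemma mul_star_eq0 x : x ** x^# = 0 -> x = 0.
Proof.
move=> E; rewrite -[x]cs_starK (star_mul_eq0 (x := x^#)) ?cs_star0 //.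
by rewrite cs_starK.
Qed.

(** A Pythagorean identity: in the C*-identity for [f + 'i *: g] the two cross terms carry opposite
    signs and cancel. *)
Lemma cs_norm_addi (f g : T) : f^# ** g = g^# ** f ->
  N (f + 'i *: g) ^+ 2 = N (f^# ** f + g^# ** g).
Proof.
move=> E; rewrite -cs_normC cs_starD cs_starZi cs_mulDl !cs_mulDr !cs_mulNl.
rewrite !(cs_mulZl, cs_mulZr) E scalerA -expr2 sqr_i scaleN1r opprK.
by rewrite addrA addrK.
Qed.

(** [f] is the average of [f + 'i *: g] and [f - 'i *: g], which have equal norms by the identity
    above. This replaces monotonicity of the norm on positive elements. *)
Lemma cs_normD_commuting (f g : T) : f^# ** g = g^# ** f ->
  N f ^+ 2 <= N (f^# ** f + g^# ** g).
Proof.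
move=> E.
set M := N (_ + _).
have H1 : N (f + 'i *: g) ^+ 2 = M := cs_norm_addi E.
have H2 : N (f - 'i *: g) ^+ 2 = M.
  have := @cs_norm_addi f (- g); rewrite scalerN cs_starN !cs_mulNl !cs_mulNr opprK.
  by apply; rewrite E.
have : 2 * N f <= N (f + 'i *: g) + N (f - 'i *: g).
  apply: le_trans (cs_normD _ _); rewrite addrACA subrr addr0 -mulr2n -scaler_nat.
  by rewrite -(rmorph_nat (real_complex R)) cs_normZR normr_nat.
have -> : N (f - 'i *: g) = N (f + 'i *: g).
  by apply/eqP; rewrite -(@eqrXn2 _ 2) ?cs_norm_ge0 // H1 H2.
rewrite -H1 => H; rewrite lerXn2r // ?nnegrE ?cs_norm_ge0 //; lra.
Qed.

End CStarAlgebraTheory.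

(** * Lower bounds of operators *)

Section Operators.
Variables (R : realType) (A : CStarAlgebra R).
Local Notation T := (cs_V A).
Local Notation N := (@cs_norm R A).
Local Notation "x ** y" := (@cs_mul R A x y) (at level 40, left associativity).
Implicit Types (x y z a b c d h s : T) (t u m e : R) (P Q H : T -> T).

(** Self-adjointness for the [A]-valued inner product [x^# ** y]. *)
Definition symmetric_op H := forall x y, (H x)^# ** y = x^# ** H y.
Definition bounded_op H M := forall x, N (H x) <= M * N x.

(* [P >= - m] in the sense of Lumer and Phillips: the semigroup [exp (- t P)]
   grows at most like [exp (t m)]. *)
Definition lower_bound P m := forall u, m < u -> exists2 e0, 0 < e0 &
  forall e, 0 < e -> e <= e0 ->
  bounded_op (fun x => x - e%:C *: P x) (1 + u * e).

Lemma eq_lower_bound P Q m : P =1 Q -> lower_bound P m -> lower_bound Q m.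
Proof. by move=> /funext ->. Qed.

Lemma bounded_lower_bound P M : bounded_op P M -> lower_bound P M.
Proof.
move=> HP u Mu; exists 1 => // e e0 _ x; apply: le_trans (cs_normB _ _) _.
rewrite cs_normZR gtr0_norm // mulrDl mul1r lerD2l.
apply: le_trans (ler_wpM2l (ltW e0) (HP x)) _.
have : 0 <= e * N x by rewrite mulr_ge0 ?cs_norm_ge0 // ltW.
nra.
Qed.

Lemma lower_bound_scale t : lower_bound (fun x => t%:C *: x) (- t).
Proof.
move=> u tu; exists (`|t| + 1)^-1; first by rewrite invr_gt0 ltr_pwDr.
move=> e e0 e1 x.
have et : e * (`|t| + 1) <= 1 by rewrite -ler_pdivlMr ?ltr_pwDr // div1r.
have tt := ler_norm t.
rewrite scalerA -rmorphM /= -[X in X - _]scale1r -(rmorph1 (real_complex R)).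
rewrite -scalerBl -rmorphB cs_normZR ler_wpM2r ?cs_norm_ge0 //.
rewrite ger0_norm; nra.
Qed.

(** [1 - e (P + Q)] is the average of [1 - 2 e P] and [1 - 2 e Q]. *)
Lemma lower_boundD P Q m u : lower_bound P m -> lower_bound Q u ->
  lower_bound (fun x => P x + Q x) (m + u).
Proof.
move=> HP HQ v muv; set w := (v - (m + u)) / 2.
have w0 : 0 < w by rewrite /w; lra.
have [e1 e10 H1] : exists2 e0, 0 < e0 & forall e, 0 < e -> e <= e0 ->
  bounded_op (fun x => x - e%:C *: P x) (1 + (m + w) * e) by apply: HP; lra.
have [e2 e20 H2] : exists2 e0, 0 < e0 & forall e, 0 < e -> e <= e0 ->
  bounded_op (fun x => x - e%:C *: Q x) (1 + (u + w) * e) by apply: HQ; lra.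
exists (Num.min e1 e2 / 2) => [|e e0 ee x]; first by rewrite divr_gt0 // lt_min e10.
have [ea eb] : 2 * e <= e1 /\ 2 * e <= e2.
  have : 2 * e <= Num.min e1 e2 by lra.
  by rewrite le_min => /andP[].
have e20' : 0 < 2 * e by lra.
have -> : x - e%:C *: (P x + Q x) = (2^-1)%:C *:
  ((x - (2 * e)%:C *: P x) + (x - (2 * e)%:C *: Q x)).
  rewrite addrACA -opprD -scalerDr scalerBr scalerA -rmorphM /= mulKf ?pnatr_eq0 //.
  congr (_ - _); rewrite -mulr2n -scaler_nat scalerA -(rmorph_nat (real_complex R)).
  by rewrite -rmorphM /= mulVf ?pnatr_eq0 // [_%:C]rmorph1 scale1r.
rewrite cs_normZR gtr0_norm ?invr_gt0 //.
have := cs_normD (x - (2 * e)%:C *: P x) (x - (2 * e)%:C *: Q x).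
have := H1 _ e20' ea x; have := H2 _ e20' eb x.
have -> : v = m + u + 2 * w by rewrite /w; field.
move: (N x) (N _) (N _) (N _) => X Y1 Y2 Y3; lra.
Qed.

Lemma lower_boundZ P m t : 0 < t -> lower_bound P m ->
  lower_bound (fun x => t%:C *: P x) (t * m).
Proof.
move=> t0 HP u tmu.
have [|e0 e00 He] := HP (u / t); first by rewrite ltr_pdivlMr // mulrC.
exists (e0 / t) => [|e e1 e2 x]; first by rewrite divr_gt0.
have := He (e * t); rewrite mulr_gt0 // -ler_pdivlMr // => /(_ isT e2 x).
rewrite scalerA -rmorphM /= => H.
have -> : 1 + u * e = 1 + u / t * (e * t) by field; rewrite gt_eqF.
exact: H.
Qed.

(** With [f = x - e H^2 x] and [g = sqrt (2 e) H x], the terms of order [e] cancel in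
    [f^# f + g^# g], so [f] exceeds [x] in norm only by a factor [1 + O(e^2)]. *)
Lemma lower_bound_sqr H M : symmetric_op H -> 0 <= M -> bounded_op H M ->
  lower_bound (fun x => H (H x)) 0.
Proof.
move=> sH M0 bH u u0; have M4 : 0 <= M ^+ 4 by rewrite exprn_ge0.
(* For such [e], [e ^+ 2 * M ^+ 4 <= 2 * u * e], hence [1 + e ^+ 2 * M ^+ 4 <= (1 + u * e) ^+ 2]. *)
exists (2 * u / (M ^+ 4 + 1)) => [|e e0]; first by rewrite divr_gt0; lra.
rewrite ler_pdivlMr => [ee x|]; last by lra.
pose f := x - e%:C *: H (H x); pose g := (Num.sqrt (2 * e))%:C *: H x.
have sq : Num.sqrt (2 * e) * Num.sqrt (2 * e) = 2 * e.
  by rewrite -expr2 sqr_sqrtr // mulr_ge0 // ltW.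
have gs : g^# ** f = f^# ** g.
  rewrite /f /g cs_starB !cs_starZR !(cs_mulZl, cs_mulZr, cs_mulBl, cs_mulBr).
  by rewrite !sH scalerBr !scalerA [e%:C * _]mulrC.
rewrite -/f.
have eff : f^# ** f + g^# ** g = x^# ** x + (e ^+ 2)%:C *: ((H (H x))^# ** H (H x)).
  rewrite /f /g cs_starB !cs_starZR !(cs_mulZl, cs_mulZr, cs_mulBl, cs_mulBr).
  rewrite !sH scalerA -rmorphM /= sq scalerBr scalerA -rmorphM /= -expr2.
  rewrite -[2 * e]/((1 + 1) * e) mulrDl !mul1r rmorphD scalerDl.
  move: (_ *: (x^# ** H (H x))) => U; move: (_ *: _) => V.
  by rewrite opprB addrACA !subrK.
have nf := cs_normD_commuting (esym gs).
have n2 : N (H (H x)) <= M ^+ 2 * N x.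
  by rewrite expr2 -mulrA; apply: le_trans (bH _) _; rewrite ler_wpM2l.
have n0 := cs_norm_ge0 x.
have nn : N f ^+ 2 <= (1 + e ^+ 2 * M ^+ 4) * N x ^+ 2.
  apply: (le_trans nf); rewrite eff; apply: le_trans (cs_normD _ _) _.
  rewrite cs_normZR !cs_normC ger0_norm ?sqr_ge0 // mulrDl mul1r lerD2l.
  rewrite -mulrA ler_wpM2l ?sqr_ge0 //.
  have -> : M ^+ 4 = (M ^+ 2) ^+ 2 by rewrite -exprM.
  rewrite -exprMn.
  by rewrite lerXn2r ?nnegrE ?cs_norm_ge0 // mulr_ge0 ?sqr_ge0.
have p0 : 0 <= 1 + u * e by rewrite addr_ge0 // mulr_ge0 // ltW.
rewrite -(@ler_pXn2r _ 2) ?nnegrE ?cs_norm_ge0 ?mulr_ge0 // exprMn.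
apply: (le_trans nn); rewrite ler_wpM2r ?sqr_ge0 //; nra.
Qed.

(** Norm equals spectral radius for symmetric operators: [|H^n x|^2 <= |x| |H^(2n) x|], iterated
    along powers of two, bounds [(|H x| / |x|)^(2^k)] by [|H^(2^k) x| / |x|], and a factor linear in
    the exponent is harmless. *)
Lemma symmetric_op_power_bound H M K : symmetric_op H -> 0 < M -> 0 <= K ->
  (forall n, bounded_op (iter n H) ((1 + n%:R * K) * M ^+ n)) -> bounded_op H M.
Proof.
move=> sH M0 K0 HK x.
have [->|/cs_norm_gt0 x0] := pselect (x = 0).
  by have := HK 1%N 0; rewrite cs_norm0 !mulr0.
have sn n y z : (iter n H y)^# ** z = y^# ** iter n H z.
  by elim: n y z => //= n IH y z; rewrite sH IH -iterSr.
have st n : N (iter n H x) ^+ 2 <= N x * N (iter (n + n) H x).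
  by rewrite -cs_normC sn -iterD (le_trans (cs_normM _ _)) // cs_norm_star.
pose r := N (H x) / (M * N x).
have Mx : 0 < M * N x by rewrite mulr_gt0.
suff : r <= 1 by rewrite ler_pdivrMr // mul1r.
apply: (@le1_of_expr2n_le _ r K) => // k.
have main : N (H x) ^+ (2 ^ k) * N x <= N x ^+ (2 ^ k) * N (iter (2 ^ k) H x).
  elim: k => [|k IH]; first by rewrite !expr1 mulrC.
  rewrite expnSr !exprM -(ler_pM2r x0).
  have := st (2 ^ k)%N; rewrite addnn -mul2n mulnC.
  set a1 := N (H x) ^+ (2 ^ k) in IH *; set a2 := N x ^+ (2 ^ k) in IH *.
  set a3 := N (iter (2 ^ k) H x) in IH *; set a4 := N (iter (2 ^ k * 2) H x).
  have a10 : 0 <= a1 by rewrite exprn_ge0 ?cs_norm_ge0.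
  have a20 : 0 <= a2 by rewrite exprn_ge0 ?cs_norm_ge0.
  have a30 : 0 <= a3 by rewrite cs_norm_ge0.
  have : (a1 * N x) ^+ 2 <= (a2 * a3) ^+ 2.
    by rewrite lerXn2r // ?nnegrE ?mulr_ge0 // ltW.
  move: (N x) => X I J; have := ler_wpM2l (sqr_ge0 a2) J; nra.
rewrite /r expr_div_n exprMn ler_pdivrMr ?mulr_gt0 ?exprn_gt0 //.
rewrite -(ler_pM2r x0); apply: (le_trans main).
apply: (le_trans (ler_wpM2l (exprn_ge0 (2 ^ k) (cs_norm_ge0 x)) (HK _ x))).
by rewrite le_eqVlt; apply/orP; left; apply/eqP; ring.
Qed.

(* [(1 - e d c)^n = 1 - e d (\sum_(j < n) (1 - e c d)^j) c], so that the powers of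
   [1 - e d c] grow at most [n] times faster than those of [1 - e c d]. *)
Lemma lower_bound_mulC c d m : 0 <= m -> (d ** c)^# = d ** c ->
  lower_bound (cs_mul (c ** d)) m -> lower_bound (cs_mul (d ** c)) m.
Proof.
move=> m0 dc Hcd u mu; have [e0 e00 He] := Hcd u mu.
exists e0 => // e ep ee; have bT := He e ep ee.
set M := 1 + u * e in bT *.
have M1 : 1 <= M by rewrite lerDl mulr_ge0 // ?ltW // (le_lt_trans m0).
set S := fun x => x - _.
have W n x : exists2 w, iter n S x = x - e%:C *: (d ** w)
                      & N w <= n%:R * M ^+ n * N (c ** x).
  elim: n => [|n [w E B]].
    by exists 0; rewrite ?cs_mul0r ?scaler0 ?subr0 // cs_norm0 !mul0r.
  (* The recurrence [w' = c x + (1 - e c d) w] of the geometric sum. *)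
  exists (c ** x + (w - e%:C *: (c ** d ** w))).
    rewrite iterS E /S !(cs_mulDr, cs_mulNr) !cs_mulZr !cs_mulA.
    rewrite !(scalerDr, scalerN) !opprD -!addrA; congr (_ + _).
    by rewrite addrCA.
  apply: le_trans (cs_normD _ _) _; apply: le_trans (lerD (lexx _) (bT w)) _.
  have Mn : 1 <= M ^+ n by rewrite exprn_ege1.
  have MM : 1 <= M * M ^+ n by rewrite mulr_ege1.
  have := ler_wpM2l (le_trans ler01 M1) B.
  have := ler_wpM2r (cs_norm_ge0 (c ** x)) MM.
  rewrite -natr1 exprS; move: (N (c ** x)) (N w) => X Y; nra.
have K0 : 0 <= e * N d * N c by rewrite !mulr_ge0 ?cs_norm_ge0 // ltW.
apply: (@symmetric_op_power_bound _ _ (e * N d * N c)) => //.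
- move=> x y; rewrite /S cs_starB cs_starZR cs_starM dc.
  by rewrite cs_mulBl cs_mulBr cs_mulZl cs_mulZr -!cs_mulA.
- by apply: lt_le_trans M1.
move=> n x; have [w -> B] := W n x.
apply: le_trans (cs_normB _ _) _; rewrite cs_normZR gtr0_norm //.
have := cs_normM d w; have := cs_normM c x; have := cs_norm_ge0 x.
have := cs_norm_ge0 d; have := cs_norm_ge0 c.
have Mn : 1 <= M ^+ n by rewrite exprn_ege1.
have n0 : 0 <= n%:R :> R by [].
move: K0 B; move: (N (d ** w)) (N (c ** x)) (N d) (N c) (N x) (N w) (M ^+ n) Mn (n%:R) n0.
move=> Dw Cx D C X W' Mn Mn1 n' n0 K0 B C0 D0 X0 C1 D1.
have h1 : W' <= n' * Mn * (C * X).
  by apply: le_trans B _; rewrite ler_wpM2l // mulr_ge0 // (le_trans ler01).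
have h2 : e * Dw <= e * (D * (n' * Mn * (C * X))).
  by rewrite ler_wpM2l ?(ltW ep) // (le_trans D1) // ler_wpM2l.
apply: le_trans (lerD (lexx _) h2) _.
have : X <= Mn * X by rewrite ler_peMl.
clear h1 h2 B C1 D1; nra.
Qed.

(** * From two-sided lower bounds to norm bounds, by averaging over roots of unity *)

Lemma iter_add_scale_expansion H e n x :
  (forall y z, H (y + z) = H y + H z) -> (forall (k : R[i]) y, H (k *: y) = k *: H y) ->
  exists c : nat -> T, [/\ c 1%N = (n%:R * e)%:C *: H x,
    forall j, (n < j)%N -> c j = 0 &
    forall w : R[i], iter n (fun y => y + (e%:C * w) *: H y) x =
                     \sum_(j < n.+1) w ^+ j *: c j].
Proof.
move=> HD HZ; have H0 : H 0 = 0 by rewrite -(scale0r (0 : T)) HZ !scale0r.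
(* The induction also carries [c 0 = x], since each step adds [e H (c 0)] to the linear
   coefficient. *)
suff [c [_ c1 cn cE]] : exists c : nat -> T, [/\ c 0%N = x, c 1%N = (n%:R * e)%:C *: H x,
    forall j, (n < j)%N -> c j = 0 &
    forall w : R[i], iter n (fun y => y + (e%:C * w) *: H y) x =
                     \sum_(j < n.+1) w ^+ j *: c j] by exists c.
elim: n => [|n [c [c0 c1 cn cE]]].
  exists (fun j => if j is 0%N then x else 0); split=> //.
  - by rewrite mul0r rmorph0 scale0r.
  - by case.
  by move=> w; rewrite big_ord1 expr0 scale1r.
exists (fun j => c j + (if j is i.+1 then e%:C *: H (c i) else 0)); split.
- by rewrite c0 addr0.
- by rewrite c1 c0 -scalerDl -rmorphD -natr1 mulrDl mul1r.
- by case=> // j nj; rewrite !cn ?H0 ?scaler0 ?addr0 // ltnW.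
move=> w; rewrite iterS cE.
under [RHS]eq_bigr do rewrite scalerDr.
rewrite big_split /=; congr (_ + _).
  by rewrite [RHS]big_ord_recr /= cn // scaler0 addr0.
rewrite [RHS]big_ord_recl scaler0 add0r (big_morph H HD H0) scaler_sumr.
apply: eq_bigr => j _; rewrite HZ !scalerA /= /bump leq0n add1n exprS.
by congr (_ *: _); ring.
Qed.

(** The weight [(z ^+ i) ^+ n] is the inverse of [z ^+ i], so the average extracts the linear
    coefficient: for [j <= n], [n.+1] divides [n + j] only when [j = 1]. *)
Lemma sum_prim_root (F : fieldType) (n j : nat) (z : F) : (0 < n)%N -> (j < n.+1)%N ->
  n.+1.-primitive_root z ->
  \sum_(i < n.+1) (z ^+ i) ^+ (n + j) = if j == 1%N then n.+1%:R else 0.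
Proof.
move=> n0 jn pz.
have E i : (z ^+ i) ^+ (n + j) = (z ^+ (n + j)) ^+ i by rewrite -!exprM mulnC.
under eq_bigr do rewrite E.
case: eqP => [->|/eqP j1].
  under eq_bigr do rewrite addn1 (prim_expr_order pz) expr1n.
  by rewrite sumr_const card_ord.
have w1 : z ^+ (n + j) - 1 != 0.
  rewrite subr_eq0 -(prim_order_dvd pz); apply/negP => /dvdnP [q Hq].
  case: q Hq => [|[|q]] Hq; first lia; last by nia.
  by move/eqP: j1; lia.
apply: (mulfI w1); rewrite -subrX1 mulr0 -exprM mulnC exprM (prim_expr_order pz).
by rewrite expr1n subrr.
Qed.

(* Averaging [w^-1 (1 + e w H)^n] over the [n.+1]-th roots of unity [w] leaves
   the linear term [n e H]. *)
Lemma bounded_op_rotations H e M n : (0 < n)%N -> 0 <= e ->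
  (forall y z, H (y + z) = H y + H z) -> (forall (k : R[i]) y, H (k *: y) = k *: H y) ->
  0 <= M ->
  (forall w : R[i], `|w| = 1 -> bounded_op (fun y => y + (e%:C * w) *: H y) M) ->
  forall x, n%:R * e * N (H x) <= M ^+ n * N x.
Proof.
move=> n0 e0 HD HZ M0 HM x.
have [|z pz] := @prim_root_exists R[i] n.+1 isT; first by rewrite pnatr_eq0.
have [c [c1 cn cE]] := @iter_add_scale_expansion H e n x HD HZ.
pose f w := iter n (fun y => y + (e%:C * w) *: H y) x.
have nz i : `|z ^+ i| = 1.
  rewrite normrX; suff -> : `|z| = 1 by rewrite expr1n.
  apply/eqP; rewrite -(@pexpr_eq1 _ _ n.+1) // -normrX (prim_expr_order pz).
  by rewrite normr1.
have Nf i : N (f (z ^+ i)) <= M ^+ n * N x.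
  rewrite /f; elim: (n) => [|k IH]; first by rewrite mul1r.
  by rewrite iterS exprS -mulrA; apply: le_trans (HM _ (nz i) _) _; rewrite ler_wpM2l.
have S : \sum_(i < n.+1) (z ^+ i) ^+ n *: f (z ^+ i) = n.+1%:R *: c 1%N.
  under eq_bigr => i _ do rewrite /f cE scaler_sumr.
  rewrite exchange_big /=.
  under eq_bigr => j _.
    under eq_bigr do rewrite scalerA -exprD.
    rewrite -scaler_suml (sum_prim_root n0 (ltn_ord j) pz).
    over.
  have n1 : (1 < n.+1)%N by [].
  rewrite (bigD1 (Ordinal n1)) //= big1 ?addr0 // => i i1.
  by case: eqP => [E|]; rewrite ?scale0r //; case/eqP: i1; apply: val_inj.
have : N (n.+1%:R *: c 1%N) <= \sum_(i < n.+1) M ^+ n * N x.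
  rewrite -S; apply: le_trans (cs_norm_sum _ _) _; apply: ler_sum => i _.
  by rewrite cs_norm_unit ?Nf // normrX nz expr1n.
rewrite sumr_const card_ord c1.
rewrite -(rmorph_nat (real_complex R)) !cs_normZR normr_nat -[leRHS]mulr_natl.
rewrite ger0_norm ?mulr_ge0 //; rewrite ler_pM2l //.
Qed.

(** In the spirit of Bohnenblust and Karlin. For [|w| = 1], [1 + e w H] is the average of a real
    part, controlled by the two lower bounds, and an imaginary part, which symmetry makes
    [1 + O(e^2)]. Averaging the power [4 k] over [w] then costs [(5 / 4)^4], and
    [4 k e = 4 / (5 m')] gives the total [(5 / 4)^5 = 3125 / 1024]. *)
Lemma bounded_op_of_lower_bound H B m :
  (forall y z, H (y + z) = H y + H z) -> (forall (k : R[i]) y, H (k *: y) = k *: H y) ->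
  symmetric_op H -> bounded_op H B -> 0 <= B -> 0 <= m ->
  lower_bound H m -> lower_bound (fun x => - H x) m ->
  bounded_op H (3125%:R / 1024%:R * m).
Proof.
move=> HD HZ sH bH B0 m0 Hp Hm x.
(* The slack [m' - m] absorbs the error of order [e^2]; a midpoint argument removes it. *)
suff main m' : m < m' -> N (H x) <= 3125%:R / 1024%:R * m' * N x.
  have [->|/cs_norm_gt0 x0] := pselect (x = 0).
    by have := bH 0; rewrite cs_norm0 !mulr0.
  rewrite leNgt; apply/negP; rewrite -ltr_pdivlMr //.
  rewrite mulrC -ltr_pdivlMr; last by lra.
  set q := _ / _ / _ => mq; have := main ((m + q) / 2); rewrite -ler_pdivrMr //.
  rewrite [_ / _ * _]mulrC -ler_pdivrMr; last by lra.
  rewrite -/q => /(_ _); lra.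
move=> mm; set u := (m + m') / 2; have mu : m < u by rewrite /u; lra.
have [um' u0 m'0] : [/\ u < m', 0 < u & 0 < m'] by rewrite /u; split; lra.
have [e1 e10 H1] := Hp u mu; have [e2 e20 H2] := Hm u mu.
(* Ensures [2 * e * B ^+ 2 <= m' - u] below [e3]. *)
pose e3 := (m' - u) / (2 * B ^+ 2 + 1).
have B2 : 0 <= B ^+ 2 by rewrite sqr_ge0.
have e30 : 0 < e3 by rewrite divr_gt0; lra.
pose e0 := Num.min (Num.min e1 e2 / 2) e3.
have e00 : 0 < e0 by rewrite lt_min e30 andbT divr_gt0 // lt_min e10.
pose k := (Num.bound (5 * m' * e0)^-1).+1.
have k0 : 0 < k%:R :> R by rewrite ltr0n.
pose e := (5 * k%:R * m')^-1.
have ep : 0 < e by rewrite invr_gt0 !mulr_gt0.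
have ee0 : e <= e0.
  have X0 : 0 < 5 * m' * e0 by rewrite !mulr_gt0.
  have : (5 * m' * e0)^-1 <= k%:R.
    apply: (@le_trans _ _ (Num.bound (5 * m' * e0)^-1)%:R); last by rewrite ler_nat.
    by rewrite ltW // archi_boundP // invr_ge0 ltW.
  rewrite -div1r ler_pdivrMr // => h.
  by rewrite /e -div1r ler_pdivrMr ?mulr_gt0 //; lra.
have [ea eb ec] : [/\ 2 * e <= e1, 2 * e <= e2 & e <= e3].
  move: ee0; rewrite le_min ler_pdivlMr // le_min => /andP[/andP[]].
  by rewrite [e * 2]mulrC => -> -> ->.
have eB : 2 * e * B ^+ 2 <= m' - u.
  by move: ec; rewrite /e3 ler_pdivlMr; nra.
have M0 : 0 <= 1 + e * m' by nra.
have key w : `|w| = 1 -> bounded_op (fun y => y + (e%:C * w) *: H y) (1 + e * m').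
  move=> w1 y; set al := complex.Re w; set be := complex.Im w.
  have ab : al ^+ 2 + be ^+ 2 = 1.
    by apply: (@complexI R); rewrite add_Re2_Im2 w1 expr1n.
  have al1 : `|al| <= 1 by rewrite ler_norml; nra.
  have [al2 al3] : 2 * e * al <= 2 * e /\ - (2 * e * al) <= 2 * e.
    by move: al1; rewrite ler_norml => /andP[]; split; nra.
  have Nr : N (y + (2 * e * al)%:C *: H y) <= (1 + 2 * e * u) * N y.
    have [al0|al0|->] := ltgtP al 0; last first.
    - rewrite mulr0 rmorph0 scale0r addr0 ler_peMl ?cs_norm_ge0 // lerDl.
      by nra.
    - have := H2 (2 * e * al) _ _ y; rewrite scalerN opprK => Hy.
      apply: le_trans (Hy _ _) _; [nra|lra|].
      by rewrite ler_wpM2r ?cs_norm_ge0 //; nra.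
    have := H1 (2 * e * - al) _ _ y; rewrite mulrN rmorphN scaleNr opprK => Hy.
    apply: le_trans (Hy _ _) _; [nra|lra|].
    by rewrite ler_wpM2r ?cs_norm_ge0 //; nra.
  set g := (2 * e * be)%:C *: H y.
  have gy : y^# ** g = g^# ** y by rewrite /g cs_starZR cs_mulZl cs_mulZr sH.
  have Ni : N (y + 'i *: g) <= (1 + 4 * e ^+ 2 * B ^+ 2) * N y.
    have p1 : 0 <= 4 * e ^+ 2 * B ^+ 2 by have := mulr_ge0 (sqr_ge0 e) (sqr_ge0 B); lra.
    rewrite -(@ler_pXn2r _ 2) ?nnegrE ?cs_norm_ge0 ?mulr_ge0 ?cs_norm_ge0 //; last lra.
    rewrite cs_norm_addi // (le_trans (cs_normD _ _)) // !cs_normC.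
    have : N g ^+ 2 <= (4 * e ^+ 2 * B ^+ 2) * N y ^+ 2.
      have -> : 4 * e ^+ 2 * B ^+ 2 * N y ^+ 2 = (2 * e * (B * N y)) ^+ 2 by ring.
      rewrite lerXn2r ?nnegrE ?cs_norm_ge0 ?mulr_ge0 ?cs_norm_ge0 ?(ltW ep) //.
      rewrite /g cs_normZR normrM gtr0_norm ?mulr_gt0 //.
      have be1 : `|be| <= 1 by rewrite ler_norml; nra.
      have bB : `|be| * N (H y) <= B * N y.
        by apply: le_trans (bH y); rewrite ler_piMl ?cs_norm_ge0.
      have e2p : 0 <= 2 * e by lra.
      by have := ler_wpM2l e2p bB; rewrite !mulrA.
    have := sqr_ge0 (N y); nra.
  have -> : y + (e%:C * w) *: H y =
      (2^-1)%:C *: ((y + (2 * e * al)%:C *: H y) + (y + 'i *: g)).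
    rewrite addrACA scalerDr /g scalerA -scalerDl scalerA -mulr2n -scaler_nat scalerA.
    rewrite -(rmorph_nat (real_complex R)) -rmorphM /= mulVf ?pnatr_eq0 //.
    rewrite [1%:C]rmorph1 scale1r; congr (_ + _ *: _).
    rewrite [w]complexE -/al -/be !mulrDr mulrCA [in RHS]mulrCA -!rmorphM /=.
    by congr (_%:C + _ * _%:C); field.
  rewrite cs_normZR gtr0_norm ?invr_gt0 //.
  have := cs_normD (y + (2 * e * al)%:C *: H y) (y + 'i *: g).
  have : 2 * e ^+ 2 * B ^+ 2 * N y <= e * (m' - u) * N y.
    by rewrite ler_wpM2r ?cs_norm_ge0 //; nra.
  move: Nr Ni; move: (N _) (N _) (N _) (N _) => X1 X2 X3 X4; nra.
have := @bounded_op_rotations H e _ (4 * k) _ (ltW ep) HD HZ M0 key x.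
have -> : (4 * k)%:R * e = 4 / 5 / m' by rewrite natrM /e; field; rewrite !gt_eqF.
have -> : e * m' = (5 * k%:R)^-1 by rewrite /e; field; rewrite !gt_eqF.
have := @expr_1p_inv_le R k isT => h1 /(_ isT) h2.
have := le_trans h2 (ler_wpM2r (cs_norm_ge0 x) h1).
rewrite mulrAC ler_pdivrMr // => h3; lra.
Qed.

End Operators.

(** * Elements anticommuting with a positive element *)

Section Anticommuting.
Variables (R : realType) (A : CStarAlgebra R).
Local Notation T := (cs_V A).
Local Notation N := (@cs_norm R A).
Local Notation "x ** y" := (@cs_mul R A x y) (at level 40, left associativity).
Implicit Types (x y z a b c d h p s : T) (t u m e k : R) (P Q H : T -> T).

Lemma cs_norm_sa_sqr p : p^# = p -> N (p ** p) = N p ^+ 2.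
Proof. by move=> ps; rewrite -cs_normC ps. Qed.

Lemma symmetric_mul h : h^# = h -> symmetric_op (@cs_mul R A h).
Proof. by move=> hh x y; rewrite cs_starM hh cs_mulA. Qed.

Lemma lower_bound_mul_sqr h : h^# = h -> lower_bound (@cs_mul R A (h ** h)) 0.
Proof.
move=> hh; apply: eq_lower_bound (lower_bound_sqr (symmetric_mul hh) (cs_norm_ge0 h) _).
  by move=> x; rewrite cs_mulA.
by move=> x; apply: cs_normM.
Qed.

(** Complete the square: [p + 2 k p^2 = 2 k (p + 1 / (4 k))^2 - 1 / (8 k)]; the cubic term is
    bounded by its norm. *)
Lemma lower_bound_cubic p k : p^# = p -> 0 < k ->
  lower_bound (@cs_mul R A (p + (2 * k)%:C *: (p ** p) + (k ^+ 2)%:C *: (p ** p ** p)))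
    ((8 * k)^-1 + k ^+ 2 * N p ^+ 3).
Proof.
move=> pp k0; pose G x := p ** x + ((4 * k)^-1)%:C *: x.
have sG : symmetric_op G.
  move=> x y; rewrite /G cs_starD cs_starZR cs_starM pp cs_mulDl cs_mulDr.
  by rewrite cs_mulZl cs_mulZr cs_mulA.
have k4 : 0 < (4 * k)^-1 by rewrite invr_gt0 mulr_gt0.
have bG : bounded_op G (N p + (4 * k)^-1).
  move=> x; rewrite mulrDl; apply: le_trans (cs_normD _ _) (lerD (cs_normM _ _) _).
  by rewrite cs_normZR gtr0_norm.
have G0 : 0 <= N p + (4 * k)^-1 by rewrite addr_ge0 ?cs_norm_ge0 // ltW.
have k2 : 0 < 2 * k by rewrite mulr_gt0.
have L1 := lower_boundZ k2 (lower_bound_sqr sG G0 bG).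
have L2 := @lower_bound_scale _ A (- (8 * k)^-1).
have L3 : lower_bound (fun x => (k ^+ 2)%:C *: (p ** p ** p ** x)) (k ^+ 2 * N p ^+ 3).
  apply: bounded_lower_bound => x; rewrite cs_normZR ger0_norm ?sqr_ge0 // -mulrA.
  rewrite ler_wpM2l ?sqr_ge0 // (le_trans (cs_normM _ _)) // ler_wpM2r ?cs_norm_ge0 //.
  by rewrite (le_trans (cs_normM _ _)) // cs_norm_sa_sqr // [leRHS]exprSr.
have := lower_boundD (lower_boundD L1 L2) L3.
rewrite mulr0 add0r opprK; apply: eq_lower_bound => x.
rewrite /G cs_mulDr cs_mulZr !cs_mulDl !cs_mulZl cs_mulA; congr (_ + _).
rewrite [RHS]addrC !scalerDr !scalerA -!rmorphM /= -!addrA; congr (_ + _).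
rewrite addrA -!scalerDl -!rmorphD /=.
have -> : 2 * k / (4 * k) + 2 * k / (4 * k) = 1 by field; rewrite gt_eqF.
have -> : 2 * k / (4 * k) / (4 * k) - (8 * k)^-1 = 0 by field; rewrite gt_eqF.
by rewrite rmorph0 scale0r addr0 rmorph1 scale1r.
Qed.

(* [z z^* + z^* z] is a sum of squares of self-adjoint elements. *)
Lemma lower_bound_star_swap z m : lower_bound (@cs_mul R A (- (z^# ** z))) m ->
  lower_bound (@cs_mul R A (z ** z^#)) m.
Proof.
move=> L; pose h1 := z + z^#; pose h2 := 'i *: (z - z^#).
have h1s : h1^# = h1 by rewrite /h1 cs_starD cs_starK addrC.
have h2s : h2^# = h2 by rewrite /h2 cs_starZi cs_starB cs_starK -scalerN opprB.
have half : 0 < 2^-1 :> R by rewrite invr_gt0.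
have L1 := lower_boundZ half (lower_bound_mul_sqr h1s).
have L2 := lower_boundZ half (lower_bound_mul_sqr h2s).
have := lower_boundD (lower_boundD L1 L2) L.
rewrite mulr0 !add0r; apply: eq_lower_bound => x.
rewrite -scalerDr -!cs_mulDl -cs_mulZl -cs_mulDl; congr (_ ** _).
rewrite /h1 /h2 cs_mulZl cs_mulZr scalerA -expr2 sqr_i scaleN1r.
rewrite !(cs_mulBl, cs_mulBr, cs_mulDl, cs_mulDr).
move: (z ** z) (z ** z^#) (z^# ** z) (z^# ** z^#) => u1 u2 u3 u4.
have -> : u1 + u2 + (u3 + u4) - (u1 - u2 - (u3 - u4)) = (u2 + u3) *+ 2.
  have E1 : u1 + u2 - (u1 - u2) = u2 + u2.
    by rewrite opprB [u1 + u2]addrC addrACA subrr addr0.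
  have E2 : u3 + u4 + (u3 - u4) = u3 + u3 by rewrite addrACA subrr addr0.
  by rewrite opprB [_ - (u1 - u2)]addrC addrACA E1 E2 mulr2n addrACA.
rewrite -scaler_nat scalerA -(rmorph_nat (real_complex R)) -rmorphM /=.
rewrite mulVf ?pnatr_eq0 //.
by rewrite [1%:C]rmorph1 scale1r addrK.
Qed.

Lemma anticommute_sa a b : a^# = a -> a ** (b^# ** b) = - (b^# ** b ** a) ->
  b ** a = 0.
Proof.
have [s sE] : exists s, s = b^# ** b by exists (b^# ** b).
rewrite -sE => aa as_sa; have ss : s^# = s by rewrite sE cs_starM cs_starK.
have aas : a ** a ** s = s ** a ** a.
  by rewrite -cs_mulA as_sa cs_mulNr cs_mulA as_sa cs_mulNl opprK.
have [p pE] : exists p, p = s ** a ** a by exists (s ** a ** a).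
have ap : a ** p = - (p ** a) by rewrite pE !cs_mulA as_sa !cs_mulNl.
have ps : p^# = p by rewrite pE !cs_starM ss aa cs_mulA aas.
have [y yE] : exists y, y = b ** a by exists (b ** a).
have yy : y^# ** y = - p.
  rewrite yE cs_starM aa cs_mulA -[a ** b^# ** b]cs_mulA -sE as_sa cs_mulNl pE.
  by [].
have [p0|/cs_norm_gt0 p0] := pselect (p = 0).
  by apply: star_mul_eq0; rewrite -yE yy p0 oppr0.
(* [5 / 8] nearly minimises the bound [1 / (16 c^2) + c / 2] on [p^2], where
   [k = c / |p|]. *)
have [k kE] : exists k, k = 5 / 8 / N p by exists (5 / 8 / N p).
have k0 : 0 < k by rewrite kE !divr_gt0.
have k2 : 0 < 2 * k by rewrite mulr_gt0.
pose e := (8 * k)^-1 + k ^+ 2 * N p ^+ 3.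
have eE : e = 189%:R / 320%:R * N p by rewrite /e kE; field; rewrite gt_eqF.
have e0 : 0 < e by rewrite eE; lra.
pose z := y + k%:C *: (y ** p).
have zz : - (z^# ** z) = p + (2 * k)%:C *: (p ** p) + (k ^+ 2)%:C *: (p ** p ** p).
  rewrite /z cs_starD cs_starZR cs_starM ps !(cs_mulDl, cs_mulDr, cs_mulZl, cs_mulZr).
  have E1 : y^# ** (y ** p) = - (p ** p) by rewrite cs_mulA yy cs_mulNl.
  have E2 : p ** y^# ** y = - (p ** p) by rewrite -cs_mulA yy cs_mulNr.
  have E3 : p ** y^# ** (y ** p) = - (p ** p ** p) by rewrite cs_mulA E2 cs_mulNl.
  rewrite E1 E2 E3 yy !scalerN -!opprD opprK -[2 * k]/((1 + 1) * k) mulrDl mul1r.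
  by rewrite rmorphD scalerDl expr2 rmorphM scalerA !addrA.
have Lz : lower_bound (@cs_mul R A (z ** z^#)) e.
  by apply: lower_bound_star_swap; rewrite zz; apply: lower_bound_cubic.
have L1 : lower_bound (@cs_mul R A (z^# ** z)) e.
  by apply: lower_bound_mulC Lz; rewrite ?cs_starM ?cs_starK // ltW.
(* [w = y (1 + k p)^2], so [z z^# = (w a) b^#]. Swapping the factors brings [a] to the right end,
   and moving it past [p] turns [1 + k p] into [1 - k p]. *)
pose w := y + (2 * k)%:C *: (y ** p) + (k ^+ 2)%:C *: (y ** p ** p).
have zw : z ** z^# = w ** a ** b^#.
  have ys : y^# = a ** b^# by rewrite yE cs_starM aa.
  rewrite -cs_mulA -ys /z /w cs_starD cs_starZR cs_starM ps.
  rewrite !(cs_mulDl, cs_mulDr, cs_mulZl, cs_mulZr) !cs_mulA.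
  rewrite -[2 * k]/((1 + 1) * k) mulrDl mul1r rmorphD scalerDl expr2 rmorphM.
  by rewrite scalerA !addrA.
have bw : b^# ** (w ** a) =
    p - (2 * k)%:C *: (p ** p) + (k ^+ 2)%:C *: (p ** p ** p).
  have pa x : x ** p ** a = - (x ** a ** p).
    by rewrite -!cs_mulA ap cs_mulNr opprK.
  have by_a : b^# ** y ** a = p by rewrite yE cs_mulA -sE pE.
  rewrite /w !(cs_mulDl, cs_mulDr, cs_mulZl, cs_mulZr) !cs_mulA !pa by_a.
  by rewrite !cs_mulNl opprK scalerN.
have L2 : lower_bound (@cs_mul R A (b^# ** (w ** a))) e.
  apply: lower_bound_mulC; rewrite ?(ltW e0) -?zw //.
  by rewrite bw cs_starD cs_starB !cs_starZR !cs_starM ps cs_mulA.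
(* Adding [- p (1 + k p)^2] and [p (1 - k p)^2] leaves [- 4 k p^2]. *)
have L3 : lower_bound (@cs_mul R A (- (p ** p))) (e / (2 * k)).
  have k4 : 0 < (4 * k)^-1 by rewrite invr_gt0 mulr_gt0.
  have := lower_boundZ k4 (lower_boundD L1 L2).
  have -> : (4 * k)^-1 * (e + e) = e / (2 * k) by field; rewrite gt_eqF.
  apply: eq_lower_bound => x; rewrite -cs_mulDl -cs_mulZl; congr (_ ** _).
  rewrite bw -[z^# ** z]opprK zz.
  rewrite !opprD addrACA addNr addr0 addrACA addNr add0r -opprD -scalerDl -rmorphD.
  rewrite scalerN scalerA -rmorphM /=.
  have -> : (4 * k)^-1 * (2 * k + 2 * k) = 1 by field; rewrite gt_eqF.
  by rewrite [1%:C]rmorph1 scale1r.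
(* Centering: [0 <= p^2 <= 2 t] becomes [- t <= H <= t] for [H = p^2 - t]. The resulting factor
   [(3125 / 1024 + 1) * 189 / 800] is below 1, whereas [3125 / 1024 * 189 / 400] would exceed 1. *)
pose t := e / (2 * k) / 2.
have t0 : 0 < t by rewrite !divr_gt0.
have tE : t = 189%:R / 800%:R * N p ^+ 2 by rewrite /t eE kE; field; rewrite gt_eqF.
pose H x := p ** p ** x - t%:C *: x.
have bH : bounded_op H (3125%:R / 1024%:R * t).
  apply: (@bounded_op_of_lower_bound _ _ _ (N p ^+ 2 + t)).
  - by move=> u v; rewrite /H cs_mulDr scalerDr opprD addrACA.
  - by move=> l u; rewrite /H cs_mulZr scalerBr !scalerA mulrC.
  - move=> u v; rewrite /H cs_starB cs_starZR !cs_starM ps cs_mulBl cs_mulBr.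
    by rewrite cs_mulZl cs_mulZr !cs_mulA.
  - move=> u; rewrite mulrDl; apply: le_trans (cs_normB _ _) (lerD _ _).
      by rewrite -cs_norm_sa_sqr // cs_normM.
    by rewrite cs_normZR gtr0_norm.
  - by rewrite addr_ge0 ?sqr_ge0 // ltW.
  - exact: ltW.
  - have := lower_boundD (lower_bound_mul_sqr ps) (@lower_bound_scale _ A (- t)).
    rewrite add0r opprK; apply: eq_lower_bound => x.
    by rewrite rmorphN scaleNr.
  have := lower_boundD L3 (@lower_bound_scale _ A t).
  have -> : e / (2 * k) - t = t by rewrite /t; field; rewrite gt_eqF.
  by apply: eq_lower_bound => x; rewrite /H opprB cs_mulNl addrC.
have pps : (p ** p)^# = p ** p by rewrite cs_starM ps.
have : N (p ** p) ^+ 2 <= (3125%:R / 1024%:R * t + t) * N (p ** p).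
  rewrite -(cs_norm_sa_sqr pps) mulrDl.
  have -> : p ** p ** (p ** p) = H (p ** p) + t%:C *: (p ** p) by rewrite /H subrK.
  apply: le_trans (cs_normD _ _) (lerD (bH _) _).
  by rewrite cs_normZR gtr0_norm.
have P0 : 0 < N p ^+ 2 by rewrite exprn_gt0.
rewrite (cs_norm_sa_sqr ps) [(N p ^+ 2) ^+ 2]expr2 ler_pM2r // tE => h.
by have : N p ^+ 2 <= 0; [lra | rewrite leNgt P0].
Qed.

End Anticommuting.

(** * Central annihilators of C*-factors *)

Section Factors.
Variables (R : realType) (A : CStarAlgebra R).
Local Notation T := (cs_V A).
Local Notation "x ** y" := (@cs_mul R A x y) (at level 40, left associativity).
Implicit Types (x y a b n v s : T) (S V W : set T).

(** Taking adjoints preserves the relation, so the self-adjoint case applies to [a + a^#] and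
    ['i *: (a - a^#)]. *)
Lemma anticommute_pos a b : a ** (b^# ** b) + b^# ** b ** a = 0 ->
  a ** (b^# ** b) = 0 /\ b^# ** b ** a = 0.
Proof.
set s := b^# ** b => as_sa.
have ss : s^# = s by rewrite /s cs_starM cs_starK.
have as_sa' : a^# ** s + s ** a^# = 0.
  by rewrite -{1 2}ss -!cs_starM -cs_starD addrC as_sa cs_star0.
have bD : b ** (a + a^#) = 0.
  apply: anticommute_sa; first by rewrite cs_starD cs_starK addrC.
  by apply/eqP; rewrite -addr_eq0 -/s cs_mulDl cs_mulDr addrACA as_sa as_sa' addr0.
have bB : b ** ('i *: (a - a^#)) = 0.
  apply: anticommute_sa; first by rewrite cs_starZi cs_starB cs_starK -scalerN opprB.
  apply/eqP; rewrite -addr_eq0 -/s cs_mulZl cs_mulZr -scalerDr cs_mulBl cs_mulBr.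
  by rewrite addrACA -opprD as_sa as_sa' subr0 scaler0.
have bB' : b ** (a - a^#) = 0.
  by apply/eqP; move/eqP: bB; rewrite cs_mulZr scaler_eq0 -normr_eq0 normi oner_eq0.
have ba : b ** a = 0.
  have : b ** (a + a^#) + b ** (a - a^#) = 0 by rewrite bD bB' addr0.
  rewrite -cs_mulDr addrACA subrr addr0 -mulr2n -scaler_nat cs_mulZr => /eqP.
  by rewrite scaler_eq0 pnatr_eq0 => /eqP.
have sa0 : s ** a = 0 by rewrite /s -cs_mulA ba cs_mul0r.
by split=> //; move: as_sa; rewrite sa0 addr0.
Qed.

Lemma AnnTE S : S `<=` pos [set: T] ->
  Ann [set: T] S = [set a | forall s, S s -> a ** s = 0 /\ s ** a = 0].
Proof.
move=> Spos; apply/seteqP; split=> [a [_ H] s Ss | a H].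
  have [b [_ sE]] := Spos _ Ss.
  by have := H _ Ss; rewrite sE => /anticommute_pos.
by split=> // s Ss; have [-> ->] := H _ Ss; rewrite addr0.
Qed.

(** [n] need not be positive, but [n^# ** n] is and again lies in [Ann S]; then [n^# n v = 0] forces
    [n v = 0]. *)
Lemma Ann_Ann_mul0 S v n : S `<=` pos [set: T] ->
  Ann [set: T] (Ann [set: T] S) v -> Ann [set: T] S n -> v ** n = 0 /\ n ** v = 0.
Proof.
move=> Spos [_ Vv]; rewrite AnnTE // => Nn.
have Nnn : Ann [set: T] S (n^# ** n).
  rewrite AnnTE // => s Ss; have [b [_ sE]] := Spos _ Ss.
  have [ns sn] := Nn _ Ss.
  rewrite -cs_mulA ns cs_mul0r cs_mulA; split=> //.
  have -> : s ** n^# = (n ** s)^#.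
    by rewrite cs_starM sE cs_starM cs_starK.
  by rewrite ns cs_star0 cs_mul0l.
have [_ nnv] := anticommute_pos (Vv _ Nnn).
have nv : n ** v = 0.
  apply: star_mul_eq0.
  by rewrite cs_starM -cs_mulA [n^# ** _]cs_mulA nnv cs_mul0r.
split=> //; have := Vv n; rewrite AnnTE // => /(_ Nn).
by rewrite nv addr0.
Qed.

(** Applying the C*-identity twice to [x y] exposes the factor [x a y] with [a = y y^# x^# x], so no
    unit has to be substituted for [a]. *)
Lemma mul_mul_eq0 x y : (forall a, x ** a ** y = 0) -> x ** y = 0.
Proof.
move=> H; apply: star_mul_eq0; apply: star_mul_eq0.
rewrite !cs_starM !cs_starK -!cs_mulA.
have -> : x ** (y ** (y^# ** (x^# ** (x ** y)))) = x ** (y ** y^# ** x^# ** x) ** y.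
  by rewrite !cs_mulA.
by rewrite H !cs_mul0r.
Qed.

Lemma Ann0 S : Ann [set: T] S 0.
Proof. by split=> // s _; rewrite cs_mul0l cs_mul0r addr0. Qed.

Lemma PA_setT : PA [set: T] [set: T].
Proof.
exists (pos [set: T]); split=> //; apply/seteqP; split=> // a _; split=> // n.
rewrite AnnTE // => Nn.
have [|nn _] := Nn (n^# ** n); first by exists n.
suff -> : n = 0 by rewrite cs_mul0l cs_mul0r addr0.
apply: star_mul_eq0; apply: star_mul_eq0.
by rewrite cs_starM cs_starK -cs_mulA nn cs_mul0r.
Qed.

(* For [v] in [V], [n] in [N := Ann S] and any [a], the corner [v a n] lies in
   both duals, hence [V A N = 0]; the ideals [I] and [J] then separate [V] and
   [N]. *)
Lemma cfactor_central W : cfactor A -> central W ->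
  W = @zeroset R A \/ W = [set: T].
Proof.
move=> facA [S [Spos [WE D0]]]; rewrite -WE in D0.
set N := Ann [set: T] S in WE D0.
have WN v n : W v -> N n -> v ** n = 0 /\ n ** v = 0.
  by rewrite WE; apply: Ann_Ann_mul0.
have WAN v a n : W v -> N n -> v ** a ** n = 0.
  move=> Wv Nn; suff : (dual W `&` dual N) (v ** a ** n) by rewrite D0.
  split=> x y Wx Wy.
    have [_ ny] := WN _ _ Wy Nn; have [_ nx] := WN _ _ Wx Nn.
    rewrite -[v ** a ** n ** y]cs_mulA -[v ** a ** n ** x]cs_mulA ny nx.
    by rewrite !cs_mul0r addr0.
  have [_ xv] := WN _ _ Wv Wx; have [_ yv] := WN _ _ Wv Wy.
  by rewrite !cs_mulA xv yv !cs_mul0l addr0.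
(* [I] contains [W], [J] contains [Ann S], and [I J = 0] by construction. Each of the four
   degenerate cases for [I] and [J] makes [W] or [Ann S] vanish. *)
pose I := [set x : T | forall a n, N n -> x ** a ** n = 0].
pose J := [set y : T | forall x, I x -> x ** y = 0].
have IN x n : I x -> N n -> x ** n = 0.
  by move=> Ix Nn; apply: mul_mul_eq0 => a; apply: Ix.
have iI : is_ideal I.
  split; [|split; [|split]] => [a n _|x y Ix Iy a n Nn|k x Ix a n Nn|b x Ix].
  - by rewrite !cs_mul0l.
  - by rewrite !cs_mulDl Ix // Iy // addr0.
  - by rewrite !cs_mulZl Ix // scaler0.
  split=> a n Nn; last by rewrite -[x ** b ** a]cs_mulA Ix.
  by rewrite -!cs_mulA [x ** (a ** n)]cs_mulA Ix // cs_mul0r.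
have iJ : is_ideal J.
  split; [|split; [|split]] => [x _|y z Jy Jz x Ix|k y Jy x Ix|b y Jy].
  - by rewrite cs_mul0r.
  - by rewrite cs_mulDr Jy // Jz // addr0.
  - by rewrite cs_mulZr Jy // scaler0.
  split=> x Ix; rewrite cs_mulA; last by rewrite Jy // cs_mul0l.
  by apply: Jy; have [_ [_ [_ H]]] := iI; have [] := H b x Ix.
have WI v : W v -> I v by move=> Wv a n Nn; apply: WAN.
have NJ n : N n -> J n by move=> Nn x Ix; apply: IN.
have NT : (forall n, N n -> n = 0) -> W = [set: T].
  move=> N0; rewrite WE; apply/seteqP; split=> // a _; split=> // n /N0 ->.
  by rewrite cs_mul0l cs_mul0r addr0.
have WZ : (forall v, W v -> v = 0) -> W = @zeroset R A.
  move=> W0; apply/seteqP; split=> [x /W0 //|x ->]; rewrite WE; exact: Ann0.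
have [I0|I0] := pselect (I = @zeroset R A).
  by left; apply: WZ => v /WI; rewrite I0.
have [J0|J0] := pselect (J = @zeroset R A).
  by right; apply: NT => n /NJ; rewrite J0.
have [IT|IT] := pselect (I = [set: T]).
  right; apply: NT => n Nn; apply: star_mul_eq0; apply: IN => //.
  by rewrite IT.
have [JT|JT] := pselect (J = [set: T]).
  left; apply: WZ => v Wv; apply: mul_star_eq0.
  have : J v^# by rewrite JT.
  by apply; apply: WI.
by case: (facA I J) => // x y Ix; apply.
Qed.

Lemma central_support_setT V : cfactor A -> V 0 -> V <> @zeroset R A ->
  central_support V [set: T].
Proof.
move=> facA V0 VN0; split; first exact: PA_setT.
split=> [W [Wc VW]|//]; have [W0|->//] := cfactor_central facA Wc.
case: VN0; apply/seteqP; split=> [x /VW|x ->//]; by rewrite W0.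
Qed.

End Factors.

Theorem theorem30 (R : realType) (A : CStarAlgebra R) :
  cfactor A ->
  (exists n : nat, type_I A 'I_n) \/
  (exists Xi : Type, ~ finite_set [set: Xi] /\ type_I A Xi) \/
  type_II1 A \/ type_IIinf A \/ type_III A.
Proof.
move=> facA; right; right.
have [modA|nmodA] := pselect (modular [set: cs_V A]); first by left.
right; have [pureA|] := pselect (purely_nonmodular A); first by right.
move=> /existsNP[V /not_implyP[[PV modV] Vn0]]; left; split=> //.
have V0 : V 0%R by have [S [_ ->]] := PV; apply: Ann0.
(* A one-member family, for which pairwise orthogonality is vacuous. *)
exists unit, (fun=> V), (fun=> [set: cs_V A]); split; [|split; [|split]].
- by [].
- by move=> _; apply: central_support_setT.
- by move=> [] [].
split; first exact: PA_setT.
split=> // W _ H; apply: H; by exists tt.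
Qed.
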